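(* Every Boolean control network that is Type-3 observable is also Type-1 observable. The converse is not true: there exists a Boolean control network that is Type-1 observable but not Type-3 observable.
   Context: A Boolean control network (BCN, in algebraic form) is given by positive integers $n,m,q$, with $N=2^n$, $M=2^m$, $Q=2^q$, and a system $x(t+1)=Lu(t)x(t)$, $y(t)=Hx(t)$, $t=0,1,2,\dots$, with states $x(t)\in\Delta_N$, inputs $u(t)\in\Delta_M$, outputs $y(t)\in\Delta_Q$. Here $\Delta_k$ is the set of columns of the identity matrix $I_k$; $L$ is an $N\times NM$ matrix with all columns in $\Delta_N$ and $H$ is a $Q\times N$ matrix with all columns in $\Delta_Q$. Products are semi-tensor products; concretely $Lux=L(u\otimes x)$ for $u\in\Delta_M$, $x\in\Delta_N$, with $\otimes$ the Kronecker product. For $x_0\in\Delta_N$, $p\ge 1$ and $U=u_0\cdots u_{p-1}\in(\Delta_M)^p$, put $x_{t+1}=Lu_tx_t$ for $0\le t<p$ and $(HL)_{x_0}^p(U)=(Hx_1)\cdots(Hx_p)\in(\Delta_Q)^p$. Type-1 observability: for every $x_0\in\Delta_N$ there exist $p\ge1$ and $U\in(\Delta_M)^p$ such that for all $\bar x_0\in\Delta_N$ with $\bar x_0\ne x_0$, $Hx_0=H\bar x_0$ implies $(HL)_{x_0}^p(U)\neq(HL)_{\bar x_0}^p(U)$. Type-3 observability: there exist $p\ge1$ and $U\in(\Delta_M)^p$ such that for any distinct $x_0,\bar x_0\in\Delta_N$, $Hx_0=H\bar x_0$ implies $(HL)_{x_0}^p(U)\neq(HL)_{\bar x_0}^p(U)$.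 *)

(* Defs.v *)
From mathcomp Require Import all_boot all_order all_algebra.
From mathcomp Require Import mxtens.

Set Implicit Arguments.
Unset Strict Implicit.
Unset Printing Implicit Defensive.

Local Open Scope ring_scope.

(* All matrices are 0-1 matrices; int is used as a ring of coefficients. *)

Definition Delta (k : nat) : {pred 'cV[int]_k} :=
  [pred x | [exists i, x == col i (1%:M : 'M[int]_k)]].
Arguments Delta k%_N : clear implicits.

(* The width of bcn_L is written 2 ^ m * 2 ^ n (rather than 2 ^ n * 2 ^ m) so
   as to be the height of the Kronecker product u *t x, whose row
   i * 2 ^ n + j is u_i * x_j. *)
Record BCN := MkBCN {
  bcn_n : nat;
  bcn_m : nat;
  bcn_q : nat;
  bcn_n_gt0 : (0 < bcn_n)%N;
  bcn_m_gt0 : (0 < bcn_m)%N;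
  bcn_q_gt0 : (0 < bcn_q)%N;
  bcn_L : 'M[int]_(2 ^ bcn_n, 2 ^ bcn_m * 2 ^ bcn_n);
  bcn_H : 'M[int]_(2 ^ bcn_q, 2 ^ bcn_n);
  bcn_L_logical : forall j, col j bcn_L \in Delta (2 ^ bcn_n);
  bcn_H_logical : forall j, col j bcn_H \in Delta (2 ^ bcn_q)
}.

Section BCNTheory.
Variable B : BCN.

Definition state := 'cV[int]_(2 ^ bcn_n B).
Definition input := 'cV[int]_(2 ^ bcn_m B).
Definition output := 'cV[int]_(2 ^ bcn_q B).

Definition is_state : {pred state} := Delta (2 ^ bcn_n B).
Definition is_input : {pred input} := Delta (2 ^ bcn_m B).

Definition next_state (x : state) (u : input) : state := bcn_L B *m (u *t x).
Definition read_output (x : state) : output := bcn_H B *m x.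

(* scanl yields (x_1, ..., x_p), without x_0. *)
Definition output_word (p : nat) (x0 : state) (U : p.-tuple input) :
    p.-tuple output :=
  [tuple of map read_output (scanl next_state x0 U)].

Definition type1_observable : Prop :=
  forall x0 : state, x0 \in is_state ->
  exists (p : nat) (U : p.-tuple input),
    [/\ (0 < p)%N, {in U, forall u, u \in is_input} &
      forall x0' : state, x0' \in is_state -> x0' <> x0 ->
        read_output x0 = read_output x0' ->
        output_word x0 U <> output_word x0' U].

Definition type3_observable : Prop :=
  exists (p : nat) (U : p.-tuple input),
    [/\ (0 < p)%N, {in U, forall u, u \in is_input} &
      forall x0 x0' : state, x0 \in is_state -> x0' \in is_state ->
        x0 <> x0' ->
        read_output x0 = read_output x0' ->
        output_word x0 U <> output_word x0' U].

End BCNTheory.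

(* Main.v *)
Require Import Defs.
From mathcomp Require Import all_boot all_order all_algebra.
From mathcomp Require Import mxtens.

(** A word separating all pairs of equal output in particular separates one
    state from the others, so Type-3 observability yields Type-1 observability
    with the same word for every initial state.

    For the converse, the two kinds of observability differ because only
    Type-1 lets the word depend on the initial state.  Consider the network
    with state bits [(h, b)], one input bit [u] and output [h], in which
    [(h, b)] moves to [(b, 0)] if [u = h], and to [(0, 0)] otherwise.  The pairs
    of distinct states with equal output are [{(h, 0), (h, 1)}] for [h = 0, 1].
    The input [u = h] reveals [b] in one step, so every initial state has its
    own distinguishing word of length 1; but any first input [u] merges the
    two states with [h <> u], which no continuation can tell apart.  A state
    [(h, b)] is numbered [2 h + b] below.

    The matrix form of the network is obtained from its transition and output
    functions on indices, through the logical matrix of a function. *)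

Set Implicit Arguments.
Unset Strict Implicit.
Unset Printing Implicit Defensive.

Import GRing.Theory.

Local Open Scope ring_scope.

(** * Boolean control networks given by functions on indices *)

Definition unit_col k (i : 'I_k) : 'cV[int]_k := col i 1%:M.

Lemma DeltaP k (x : 'cV[int]_k) :
  reflect (exists i, x = unit_col i) (x \in Delta k).
Proof. by apply: (iffP existsP) => -[i /eqP xi]; exists i. Qed.

Lemma unit_col_Delta k (i : 'I_k) : unit_col i \in Delta k.
Proof. by apply/DeltaP; exists i. Qed.

Lemma unit_col_inj k : injective (@unit_col k).
Proof.
move=> i j /matrixP/(_ i 0); rewrite !mxE eqxx.
by case: eqP.
Qed.

Definition logical_mx a b (f : 'I_a -> 'I_b) : 'M[int]_(b, a) :=
  \matrix_(i, j) (i == f j)%:R.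

Lemma col_logical_mx a b (f : 'I_a -> 'I_b) j :
  col j (logical_mx f) = unit_col (f j).
Proof. by apply/matrixP => i k; rewrite !mxE. Qed.

Lemma logical_mx_Delta a b (f : 'I_a -> 'I_b) j :
  col j (logical_mx f) \in Delta b.
Proof. by rewrite col_logical_mx unit_col_Delta. Qed.

Lemma mul_logical_mx a b (f : 'I_a -> 'I_b) j :
  logical_mx f *m unit_col j = unit_col (f j).
Proof. by rewrite -col_logical_mx /unit_col !colE mul1mx. Qed.

Lemma tens_unit_col a b (i : 'I_a) (j : 'I_b) :
  unit_col i *t unit_col j = unit_col (mxtens_index (i, j)).
Proof.
apply/matrixP => k l; rewrite !mxE -natrM mulnb; congr (_%:R).
by rewrite -(inj_eq (can_inj (@mxtens_unindexK a b))) mxtens_indexK -pair_eqE.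
Qed.

Section FunctionalNetwork.
Variables (n m q : nat).
Hypotheses (n_gt0 : (0 < n)%N) (m_gt0 : (0 < m)%N) (q_gt0 : (0 < q)%N).
Variables (f : 'I_(2 ^ m) -> 'I_(2 ^ n) -> 'I_(2 ^ n)).
Variables (h : 'I_(2 ^ n) -> 'I_(2 ^ q)).

Definition functional_network : BCN :=
  MkBCN n_gt0 m_gt0 q_gt0
    (logical_mx_Delta (fun k => let ux := mxtens_unindex k in f ux.1 ux.2))
    (logical_mx_Delta h).

Lemma next_state_functional x u :
  @next_state functional_network (unit_col x) (unit_col u) = unit_col (f u x).
Proof. by rewrite /next_state tens_unit_col mul_logical_mx mxtens_indexK. Qed.

Lemma read_output_functional x :
  @read_output functional_network (unit_col x) = unit_col (h x).
Proof. exact: mul_logical_mx. Qed.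

End FunctionalNetwork.

(** The states [x_1, ..., x_p] determine the output word, and they depend on
    [x_0] only through [x_1]. *)
Lemma output_word_merge (B : BCN) p (x x' : state B) (U : p.+1.-tuple (input B)) :
  next_state x (thead U) = next_state x' (thead U) ->
  output_word x U = output_word x' U.
Proof.
by case/tupleP: U => u U; rewrite theadE => e; apply/val_inj; rewrite /= e.
Qed.

(** * A network that is Type-1 but not Type-3 observable *)

Lemma half_ord_subproof (x : 'I_(2 ^ 2)) : (x./2 < 2 ^ 1)%N.
Proof. by case: x => [[|[|[|[|]]]]]. Qed.

Definition high_bit (x : 'I_(2 ^ 2)) : 'I_(2 ^ 1) :=
  Ordinal (half_ord_subproof x).

(** The target is [(1, 0)] exactly from the state [(u, 1)]. *)
Definition test_step (u : 'I_(2 ^ 1)) (x : 'I_(2 ^ 2)) : 'I_(2 ^ 2) :=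
  if x == u.*2.+1 :> nat then @Ordinal (2 ^ 2) 2 isT else @Ordinal (2 ^ 2) 0 isT.

Definition test_network : BCN :=
  @functional_network 2 1 1 isT isT isT test_step high_bit.

Lemma test_step_reveals (x x' : 'I_(2 ^ 2)) :
  high_bit x = high_bit x' ->
  high_bit (test_step (high_bit x) x) = high_bit (test_step (high_bit x) x') ->
  x = x'.
Proof.
move=> /(congr1 val) /= + /(congr1 val) + ; rewrite /test_step /=.
by case: x x' => [[|[|[|[|//]]]] xP] [[|[|[|[|//]]]] x'P] //= _ _; apply/val_inj.
Qed.

Lemma test_step_merges (u : 'I_(2 ^ 1)) :
  exists x x' : 'I_(2 ^ 2),
    [/\ x <> x', high_bit x = high_bit x' & test_step u x = test_step u x'].
Proof.
case: u => [[|[|//]] uP].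
  by exists (@Ordinal (2 ^ 2) 2 isT), (@Ordinal (2 ^ 2) 3 isT); split=> //;
     apply/val_inj.
by exists (@Ordinal (2 ^ 2) 0 isT), (@Ordinal (2 ^ 2) 1 isT); split=> //;
   apply/val_inj.
Qed.

Lemma test_network_type1 : type1_observable test_network.
Proof.
move=> _ /DeltaP[x ->].
exists 1%N, [tuple (unit_col (high_bit x) : input test_network)]; split=> //.
  by move=> u; rewrite inE => /eqP ->; apply: unit_col_Delta.
move=> _ /DeltaP[x' ->] neq; rewrite !read_output_functional => /unit_col_inj hE.
move=> /(congr1 val) [].
rewrite !next_state_functional !read_output_functional => /unit_col_inj sE.
by apply: neq; rewrite (test_step_reveals hE sE).
Qed.

Lemma test_network_not_type3 : ~ type3_observable test_network.
Proof.
move=> [[|p] [U [// _ inU sepU]]].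
have /DeltaP[u uE] : thead U \in Delta (2 ^ 1) by apply/inU/mem_tnth.
have [x [x' [neq hE sE]]] := test_step_merges u.
apply: (sepU (unit_col x) (unit_col x')).
- exact: unit_col_Delta.
- exact: unit_col_Delta.
- by move=> /unit_col_inj.
- by rewrite !read_output_functional hE.
- by apply: output_word_merge; rewrite uE !next_state_functional sE.
Qed.

(** * Comparison of the two notions *)

Lemma type3_type1 (B : BCN) : type3_observable B -> type1_observable B.
Proof.
move=> [p [U [p_gt0 inU sepU]]] x0 x0P; exists p, U; split=> // x0' x0'P neq.
by apply: sepU => // /esym.
Qed.

Theorem mainTheorem12 :
  (forall B : BCN, type3_observable B -> type1_observable B) /\
  (exists B : BCN, type1_observable B /\ ~ type3_observable B).
Proof.
split; first exact: type3_type1.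
exists test_network; split.
- exact: test_network_type1.
- exact: test_network_not_type3.
Qed.
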